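(* The inequality $$\frac{(1+\tau)^2}{2}-1\ \le\ \rho\ \le\ 1-\frac{(1-\tau)^2}{2}$$ of Durbin and Stuart is not sharp outside a countable set. That is, there is a countable set $C\subset[-1,1]$ such that for every two-dimensional copula $A$ with $\tau(A)\notin C$ one has $$\frac{(1+\tau(A))^2}{2}-1\ <\ \rho(A)\ <\ 1-\frac{(1-\tau(A))^2}{2}.$$
   Context: For a two-dimensional copula $A$, $\mu_A$ is the corresponding doubly stochastic measure on $[0,1]^2$, determined by $\mu_A([0,x]\times[0,y])=A(x,y)$. Kendall's $\tau$ and Spearman's $\rho$ of $A$ are $$\tau(A)=4\int_{[0,1]^2}A(x,y)\,d\mu_A(x,y)-1,\qquad \rho(A)=12\int_{[0,1]^2}xy\,d\mu_A(x,y)-3.$$ *)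

(* Defs.v *)
From HB Require Import structures.
From mathcomp Require Import all_boot all_order all_algebra.
From mathcomp Require Import all_classical all_reals all_analysis.

Set Implicit Arguments.
Unset Strict Implicit.
Unset Printing Implicit Defensive.

Import Order.TTheory GRing.Theory Num.Theory.
Import numFieldNormedType.Exports.

Local Open Scope classical_set_scope.
Local Open Scope ring_scope.

Definition unit_square (R : realType) : set (R * R) :=
  `[0%R, 1%R] `*` `[0%R, 1%R].

(* A two-dimensional copula is a function on [0,1]^2; it is given here by a
   total function on the plane of which only the values on [0,1]^2 matter. *)
Definition is_copula (R : realType) (A : R -> R -> R) : Prop :=
  [/\ forall x : R, 0 <= x <= 1 -> A x 0 = 0 /\ A 0 x = 0,
      forall x : R, 0 <= x <= 1 -> A x 1 = x /\ A 1 x = x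
    & forall x1 x2 y1 y2 : R,
        0 <= x1 -> x1 <= x2 -> x2 <= 1 ->
        0 <= y1 -> y1 <= y2 -> y2 <= 1 ->
        0 <= A x2 y2 - A x1 y2 - A x2 y1 + A x1 y1].

(* [mu] is the measure mu_A.  A Borel measure on [0,1]^2 is encoded as a Borel
   measure on the plane that vanishes outside [0,1]^2.  The values on the
   rectangles [0,x] x [0,y] determine it, and the margins of the copula [A]
   make it doubly stochastic. *)
Definition is_copula_measure (R : realType) (A : R -> R -> R)
    (mu : {measure set (measurableTypeR R * measurableTypeR R) -> \bar R}) :
    Prop :=
  mu (~` @unit_square R) = 0%E /\
  forall x y : R, 0 <= x <= 1 -> 0 <= y <= 1 ->
    mu (`[0%R, x] `*` `[0%R, y]) = (A x y)%:E.

Definition kendall_tau (R : realType) (A : R -> R -> R)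
    (mu : {measure set (measurableTypeR R * measurableTypeR R) -> \bar R}) :
    R :=
  4 * (\int[mu]_(p in @unit_square R) A p.1 p.2) - 1.

Definition spearman_rho (R : realType)
    (mu : {measure set (measurableTypeR R * measurableTypeR R) -> \bar R}) :
    R :=
  12 * (\int[mu]_(p in @unit_square R) (p.1 * p.2)) - 3.

(* Main.v *)
Require Import Defs.
From HB Require Import structures.
From mathcomp Require Import all_boot all_order all_algebra.
From mathcomp Require Import all_classical all_reals all_analysis.
From mathcomp Require Import measurable_realfun.
From mathcomp Require Import ring lra.

Set Implicit Arguments.
Unset Strict Implicit.
Unset Printing Implicit Defensive.

Import Order.TTheory GRing.Theory Num.Theory.
Import numFieldNormedType.Exports.

Local Open Scope classical_set_scope.
Local Open Scope ring_scope.

(** Why the theorem holds.  Let p, q, r be independent points with law mu, and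
order the plane by discordance: p precedes q when p lies to the left of q and
above it.  For a strict order, let b(p) and a(p) be the masses of the points
below and above p, and f = b + a the mass of the points comparable to p.  The
margins of a copula are uniform, so for the discordance order b - a = x - y
almost everywhere and E f = (1 - tau) / 2, while 6 E (x - y)^2 = 1 - rho.

A triangle of pairwise comparable points is a chain in exactly one of six
orders, so P(p, q, r pairwise comparable) = 6 E (b a).  Subtracting this from
P(p ~ r and q ~ r) = E f^2 leaves the defect
  Z = P(p ~ r, q ~ r, but not p ~ q) >= 0,
and (b - a)^2 = f^2 - 4 b a then gives
  3 E (b - a)^2 = E f^2 + 2 Z                (expect_imbalance_sqr).
As E f^2 >= (E f)^2 and Z >= 0, this is the upper bound of Durbin and Stuart.
Equality forces f to be almost everywhere a constant c and Z = 0, which makes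
comparability an equivalence relation almost everywhere, all of whose classes
have mass c.  Such classes either fill the whole mass 1 after finitely many
steps or have mass 0, so c = 1 / n or c = 0 (comparable_mass_inverse_nat);
hence tau lies in the countable set of the 1 - 2 / n, together with 1.  The
concordance order gives the lower bound in the same way, with b - a = x + y - 1,
E f = (1 + tau) / 2 and 6 E (x + y - 1)^2 = 1 + rho.

The moments E x = 1 / 2 and E x^2 = 1 / 3 come from the same identity, applied
to the order by abscissa: there f = 1 and Z = 0 (total_order_moments). *)

(** * Expectations of bounded measurable functions *)

Definition bounded_measurable d (T : measurableType d) (R : realType)
    (f : T -> R) :=
  measurable_fun setT f /\ exists M : R, forall x, `|f x| <= M.

Section bounded_measurable_algebra.
Context d (T : measurableType d) (R : realType).
Implicit Types f g : T -> R.

Lemma bounded_measurable_cst (c : R) : bounded_measurable (fun _ : T => c).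
Proof. by split; [exact: measurable_cst|exists `|c|]. Qed.

Lemma bounded_measurableD f g : bounded_measurable f -> bounded_measurable g ->
  bounded_measurable (fun x => f x + g x).
Proof.
move=> [mf [M fM]] [mg [N gN]]; split; first exact: measurable_funD.
by exists (M + N) => x; rewrite (le_trans (ler_normD _ _))// lerD.
Qed.

Lemma bounded_measurableM f g : bounded_measurable f -> bounded_measurable g ->
  bounded_measurable (fun x => f x * g x).
Proof.
move=> [mf [M fM]] [mg [N gN]]; split; first exact: measurable_funM.
by exists (M * N) => x; rewrite normrM ler_pM.
Qed.

Lemma bounded_measurableB f g : bounded_measurable f -> bounded_measurable g ->
  bounded_measurable (fun x => f x - g x).
Proof.
move=> [mf [M fM]] [mg [N gN]]; split; first exact: measurable_funB.
by exists (M + N) => x; rewrite (le_trans (ler_normB _ _))// lerD.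
Qed.

Lemma bounded_measurableX f n : bounded_measurable f ->
  bounded_measurable (fun x => f x ^+ n).
Proof.
move=> [mf [M fM]]; split; first exact: measurable_funX.
by exists (M ^+ n) => x; rewrite normrX lerXn2r ?nnegrE ?(le_trans _ (fM x)).
Qed.

Lemma bounded_measurable_comp d' (S : measurableType d') (h : S -> T) f :
  measurable_fun setT h -> bounded_measurable f ->
  bounded_measurable (fun x => f (h x)).
Proof.
move=> mh [mf [M fM]]; split; first exact: measurableT_comp.
by exists M.
Qed.

Lemma bounded_measurable_bool (b : T -> bool) : measurable_fun setT b ->
  bounded_measurable (fun x => (b x)%:R : R).
Proof.
move=> mb; split; last by exists 1 => x; case: (b x); rewrite ?normr0 ?normr1.
rewrite (_ : (fun _ => _) = (fun x => if b x then 1 else 0 : R)).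
  by apply: measurable_fun_ifT => //; exact: measurable_cst.
by apply/funext => x; case: (b x).
Qed.

End bounded_measurable_algebra.

Section expectation.
Context d (T : measurableType d) (R : realType) (P : probability T R).
Implicit Types f g : T -> R.

Lemma bounded_measurable_integrable f : bounded_measurable f ->
  P.-integrable setT (EFin \o f).
Proof.
move=> [mf [M fM]]; apply: measurable_bounded_integrable => //.
  by rewrite -ge0_fin_numE ?fin_num_measure.
exists M; split; first exact: num_real.
by move=> x Mx y _ /=; exact: le_trans (fM y) (ltW Mx).
Qed.

Let int := bounded_measurable_integrable.

Lemma expectD f g : bounded_measurable f -> bounded_measurable g ->
  \int[P]_x (f x + g x) = \int[P]_x f x + \int[P]_x g x.
Proof. by move=> /int ? /int ?; rewrite RintegralD. Qed.

Lemma expectB f g : bounded_measurable f -> bounded_measurable g ->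
  \int[P]_x (f x - g x) = \int[P]_x f x - \int[P]_x g x.
Proof. by move=> /int ? /int ?; rewrite RintegralB. Qed.

Lemma expectZ (c : R) f : bounded_measurable f ->
  \int[P]_x (c * f x) = c * \int[P]_x f x.
Proof. by move=> /int ?; rewrite RintegralZl. Qed.

Lemma expectZr (c : R) f : bounded_measurable f ->
  \int[P]_x (f x * c) = \int[P]_x f x * c.
Proof. by move=> /int ?; rewrite RintegralZr. Qed.

Lemma expect_cst (c : R) : \int[P]_(x in setT) c = c.
Proof.
rewrite Rintegral_cst//.
by transitivity (c * fine 1%E); [congr (_ * fine _); exact: probability_setT|
  rewrite mulr1].
Qed.

Lemma expect_ge0 f : (forall x, 0 <= f x) -> 0 <= \int[P]_x f x.
Proof. by move=> f0; exact: Rintegral_ge0. Qed.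

Lemma le_expect f g : bounded_measurable f -> bounded_measurable g ->
  (forall x, f x <= g x) -> \int[P]_x f x <= \int[P]_x g x.
Proof. by move=> /int ? /int ? fg; apply: le_Rintegral. Qed.

Lemma ae_expect f g : bounded_measurable f -> bounded_measurable g ->
  (\forall x \ae P, f x = g x) -> \int[P]_x f x = \int[P]_x g x.
Proof.
move=> /int/measurable_int mf /int/measurable_int mg fg.
congr fine; apply: ae_eq_integral => //.
by apply: filterS fg => x + _ /= => ->.
Qed.

Lemma expect_eq0 f : bounded_measurable f -> (forall x, 0 <= f x) ->
  \int[P]_x f x = 0 -> \forall x \ae P, f x = 0.
Proof.
move=> /int intf f0 f_eq0.
have fin := integrable_fin_num measurableT intf.
have : (\int[P]_x `|(EFin \o f) x| = 0)%E.
  under eq_integral do rewrite /= ger0_norm//.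
  by rewrite -(fineK fin); congr EFin.
move/(ae_eq_integral_abs _ measurableT (measurable_int _ intf)).
by apply: filterS => x /(_ I)[].
Qed.

Lemma ae_mono (Q1 Q2 : T -> Prop) : (forall x, Q1 x -> Q2 x) ->
  (\forall x \ae P, Q1 x) -> \forall x \ae P, Q2 x.
Proof. by move=> Q12; apply: filterS. Qed.

Lemma ae_mono2 (Q1 Q2 Q3 : T -> Prop) : (forall x, Q1 x -> Q2 x -> Q3 x) ->
  (\forall x \ae P, Q1 x) -> (\forall x \ae P, Q2 x) -> \forall x \ae P, Q3 x.
Proof. by move=> Q123; apply: filterS2. Qed.

Lemma ae_exists (Q : T -> Prop) : (\forall x \ae P, Q x) -> exists x, Q x.
Proof.
move=> Qae; apply: (@filter_ex _ (almost_everywhere P) _ Q) => //.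
apply: ae_properfilter_algebraOfSetsType.
by apply: (lt_le_trans lte01); rewrite -(probability_setT P).
Qed.

Lemma expect_variance f : bounded_measurable f ->
  \int[P]_x (f x - \int[P]_y f y) ^+ 2 =
  \int[P]_x f x ^+ 2 - (\int[P]_x f x) ^+ 2.
Proof.
set c := \int[P]_x f x => bf.
have -> : \int[P]_x (f x - c) ^+ 2 =
    \int[P]_x ((f x ^+ 2 - (2 * c) * f x) + c ^+ 2).
  by apply: eq_Rintegral => x _; ring.
have bf2 : bounded_measurable (fun x => f x ^+ 2) by exact: bounded_measurableX.
have bcf : bounded_measurable (fun x => (2 * c) * f x).
  by apply: bounded_measurableM => //; exact: bounded_measurable_cst.
rewrite expectD; [|exact: bounded_measurableB|exact: bounded_measurable_cst].
by rewrite expectB// expectZ// expect_cst -/c; ring.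
Qed.

Lemma le_sqr_expect f : bounded_measurable f ->
  (\int[P]_x f x) ^+ 2 <= \int[P]_x f x ^+ 2.
Proof.
move=> /expect_variance var; rewrite -subr_ge0 -var.
by apply: expect_ge0 => x; exact: sqr_ge0.
Qed.

Lemma ae_cst_of_expect_sqr f : bounded_measurable f ->
  \int[P]_x f x ^+ 2 = (\int[P]_x f x) ^+ 2 ->
  \forall x \ae P, f x = \int[P]_x f x.
Proof.
move=> bf f2.
have bv : bounded_measurable (fun x => (f x - \int[P]_y f y) ^+ 2).
  apply: bounded_measurableX; apply: bounded_measurableB => //.
  exact: bounded_measurable_cst.
have /(expect_eq0 bv (fun x => sqr_ge0 _)) :
    \int[P]_x (f x - \int[P]_y f y) ^+ 2 = 0.
  by rewrite expect_variance// f2 subrr.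
by apply: filterS => x /eqP; rewrite sqrf_eq0 subr_eq0 => /eqP.
Qed.

(** An atom at x would make the distribution function of g jump there, whereas
on [0, 1] it is the identity. *)
Lemma uniform_no_atom (g : T -> R) : measurable_fun setT g ->
  (forall x : R, 0 <= x <= 1 -> \int[P]_q (g q <= x)%R%:R = x) ->
  forall x : R, 0 <= x <= 1 -> \forall q \ae P, g q != x.
Proof.
move=> mg unif x /andP[x0 x1].
have ble y : bounded_measurable (fun q => (g q <= y)%R%:R : R).
  by apply: bounded_measurable_bool; exact: measurable_fun_ler.
have beq : bounded_measurable (fun q => (g q == x)%R%:R : R).
  by apply: bounded_measurable_bool; exact: measurable_fun_eqr.
have m_ge0 : 0 <= \int[P]_q (g q == x)%R%:R by exact: expect_ge0.
suff m0 : \int[P]_q (g q == x)%R%:R = 0.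
  move: (expect_eq0 beq (fun q => ler0n _ _) m0); apply: ae_mono => q.
  by case: eqP => //= _ /eqP; rewrite oner_eq0.
set m := Rintegral _ _ _ in m_ge0 *.
apply/eqP; rewrite eq_le m_ge0 andbT leNgt; apply/negP => m_gt0.
have mx : m <= x.
  rewrite -[leRHS]unif ?x0//; apply: le_expect => // q.
  by case: eqP => [->|_]; rewrite ?lexx// ler0n.
(* The atom would fit between x - m / 2 and x. *)
have x'01 : 0 <= x - m / 2 <= 1 by apply/andP; split; lra.
suff : m + (x - m / 2) <= x by lra.
rewrite -[leRHS]unif ?x0// -[X in _ + X]unif// -expectD//.
apply: le_expect => //; first exact: bounded_measurableD.
move=> q; case: eqP => [->|_].
  have /negbTE -> : ~~ (x <= x - m / 2) by rewrite -ltNge; lra.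
  by rewrite lexx addr0.
rewrite add0r ler_nat; case: (leP (g q) (x - m / 2)) => // gq.
by rewrite (le_trans gq)//; lra.
Qed.

End expectation.

Section iterated_expectation.
Context d1 d2 (S : measurableType d1) (T : measurableType d2) (R : realType).
Implicit Types F : S -> T -> R.

Lemma bounded_measurable_section F x :
  bounded_measurable (fun z : S * T => F z.1 z.2) -> bounded_measurable (F x).
Proof. by apply: bounded_measurable_comp (pair1_measurable x). Qed.

Lemma bounded_measurable_section2 F y :
  bounded_measurable (fun z : S * T => F z.1 z.2) ->
  bounded_measurable (F^~ y).
Proof. by apply: bounded_measurable_comp (pair2_measurable y). Qed.

Lemma bounded_measurable_expect (Q : probability T R) F :
  bounded_measurable (fun z : S * T => F z.1 z.2) ->
  bounded_measurable (fun x => \int[Q]_y F x y).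
Proof.
move=> bF; have [mF [M FM]] := bF.
have bFx x : bounded_measurable (F x) by exact: bounded_measurable_section.
split; last first.
  exists M => x; apply: (le_trans (le_normr_Rintegral _ _)) => //.
    exact: bounded_measurable_integrable.
  rewrite -[leRHS](expect_cst Q); apply: le_expect => [| |y].
  - split; last by exists M => y; rewrite normr_id (FM (x, y)).
    by apply: measurableT_comp => //; case: (bFx x).
  - exact: bounded_measurable_cst.
  - exact: (FM (x, y)).
(* Shifted by its bound M, F becomes nonnegative and Tonelli applies. *)
rewrite (_ : (fun _ => _) = fun x => \int[Q]_y (F x y + M) - M); last first.
  apply/funext => x; rewrite expectD ?expect_cst ?addrK//.
  exact: bounded_measurable_cst.
apply: measurable_funB; last exact: measurable_cst.
have /= := measurable_fun_fubini_tonelli_F (m2 := Q)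
  (fun z => (F z.1 z.2 + M)%:E).
move=> /(_ _ _)/(measurableT_comp (fine_measurable _)); apply => //.
  by apply/measurable_EFinP; apply: measurable_funD => //; exact: measurable_cst.
move=> z; rewrite lee_fin -lerBlDr sub0r lerNl (le_trans _ (FM z))//.
by rewrite -normrN ler_norm.
Qed.

Lemma expect_swap (P : probability S R) (Q : probability T R) F :
  bounded_measurable (fun z : S * T => F z.1 z.2) ->
  \int[P]_x \int[Q]_y F x y = \int[Q]_y \int[P]_x F x y.
Proof.
move=> bF; have := Fubini (bounded_measurable_integrable (P \x Q)%E bF).
rewrite /Rintegral /= => E.
transitivity (fine (\int[P]_x \int[Q]_y (F x y)%:E))%E.
  congr fine; apply: eq_integral => x _; rewrite fineK//.
  apply: integrable_fin_num => //; apply: bounded_measurable_integrable.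
  exact: bounded_measurable_section.
rewrite E; congr fine; apply: eq_integral => y _; rewrite fineK//.
apply: integrable_fin_num => //; apply: bounded_measurable_integrable.
exact: bounded_measurable_section2.
Qed.

End iterated_expectation.

Section measure_of_total_mass_one.
Context d (T : measurableType d) (R : realType).
Variables (mu : {measure set T -> \bar R}) (mu1 : mu setT = 1%E).

(** A copy of mu under a new name, on which the structure of a probability can
be declared; integrals against it and against mu are convertible. *)
Definition unit_mass_measure & mu setT = 1%E : set T -> \bar R := mu.

HB.instance Definition _ := Measure.copy (unit_mass_measure mu1) mu.

HB.instance Definition _ :=
  Measure_isProbability.Build _ _ _ (unit_mass_measure mu1) mu1.

Definition unit_mass_probability : probability T R := unit_mass_measure mu1.

End measure_of_total_mass_one.

(** * Comparability in a random strict order *)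

Ltac solve_measurable :=
  repeat first [ exact: measurable_id | exact: measurable_fst
               | exact: measurable_snd | exact: measurable_cst
               | assumption | apply: measurableT_comp ].

Section strict_order.
Context d (T : measurableType d) (R : realType) (P : probability T R).
Variable L : T -> T -> bool.

Definition below p : R := \int[P]_q (L q p)%:R.

Definition above p : R := \int[P]_q (L p q)%:R.

(** The indicator of the comparability of p and q: by asymmetry at most one of
the two terms is 1. *)
Definition comparable p q : R := (L p q)%:R + (L q p)%:R.

Definition comparable_mass p : R := \int[P]_q comparable p q.

Definition common_mass p q : R := \int[P]_r (comparable p r * comparable q r).

(** The probability that two independent points are not comparable to each
other although both are comparable to a third one. *)
Definition nontransitivity : R :=
  \int[P]_p \int[P]_q ((1 - comparable p q) * common_mass p q).

Hypothesis measurable_L : measurable_fun setT (fun z : T * T => L z.1 z.2).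
Hypothesis asymmetric_L : forall p q, L p q -> ~~ L q p.
Hypothesis transitive_L : forall q p r, L p q -> L q r -> L p r.

Lemma bounded_measurable_rel d' (S : measurableType d') (u v : S -> T) :
  measurable_fun setT u -> measurable_fun setT v ->
  bounded_measurable (fun s => (L (u s) (v s))%:R : R).
Proof.
move=> mu mv; apply: bounded_measurable_bool.
exact: (measurableT_comp measurable_L (measurable_fun_pair mu mv)).
Qed.

(* A difference is also the sum of an opposite, so differences are tried first. *)
Ltac solve_bounded := match goal with |- bounded_measurable _ =>
  rewrite /nontransitivity/common_mass/comparable_mass/comparable/above/below/=;
  repeat first
    [ exact: bounded_measurable_cst
    | apply: bounded_measurable_rel; solve [solve_measurable]
    | apply: bounded_measurable_expect | apply: bounded_measurableX
    | apply: bounded_measurableB | apply: bounded_measurableD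
    | apply: bounded_measurableM ] end.

Lemma bounded_measurable_below : bounded_measurable below.
Proof. by solve_bounded. Qed.

Lemma bounded_measurable_above : bounded_measurable above.
Proof. by solve_bounded. Qed.

Lemma bounded_measurable_comparable p : bounded_measurable (comparable p).
Proof. by solve_bounded. Qed.

Lemma bounded_measurable_comparable_mass : bounded_measurable comparable_mass.
Proof. by solve_bounded. Qed.

Lemma comparableC p q : comparable p q = comparable q p.
Proof. by rewrite /comparable addrC. Qed.

Lemma comparable_01 p q : 0 <= comparable p q <= 1.
Proof.
rewrite /comparable; have := @asymmetric_L p q.
case: (L p q); case: (L q p) => /= nLqp; first by have := nLqp isT.
all: by apply/andP; split; lra.
Qed.

Lemma comparable_massE p : comparable_mass p = above p + below p.
Proof. by rewrite /comparable_mass expectD//; solve_bounded. Qed.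

Lemma common_mass_ge0 p q : 0 <= common_mass p q.
Proof.
apply: expect_ge0 => r.
by apply: mulr_ge0; [case/andP: (comparable_01 p r)|
  case/andP: (comparable_01 q r)].
Qed.

Lemma expect_below_above : \int[P]_p below p = \int[P]_p above p.
Proof. by rewrite /below expect_swap//; solve_bounded. Qed.

Lemma expect_comparable_mass :
  \int[P]_p comparable_mass p = 2 * \int[P]_p below p.
Proof.
under eq_Rintegral do rewrite comparable_massE.
by rewrite expectD ?expect_below_above; [lra|solve_bounded..].
Qed.

(** * Triples of independent points *)

Definition expect3 (F : T -> T -> T -> R) :=
  \int[P]_p \int[P]_q \int[P]_r F p q r.

Definition bounded_measurable3 (F : T -> T -> T -> R) :=
  bounded_measurable (fun z : (T * T) * T => F z.1.1 z.1.2 z.2).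

Lemma bounded_measurable3_expect F : bounded_measurable3 F ->
  bounded_measurable (fun z : T * T => \int[P]_r F z.1 z.2 r).
Proof. by move=> bF; exact: bounded_measurable_expect. Qed.

Lemma bounded_measurable3_section F p : bounded_measurable3 F ->
  bounded_measurable (fun z : T * T => F p z.1 z.2).
Proof.
apply: (bounded_measurable_comp (h := fun z : T * T => ((p, z.1), z.2))).
apply: measurable_fun_pair; last by solve_measurable.
by apply: measurable_fun_pair; solve_measurable.
Qed.

Lemma expect3D F G : bounded_measurable3 F -> bounded_measurable3 G ->
  expect3 (fun p q r => F p q r + G p q r) = expect3 F + expect3 G.
Proof.
move=> bF bG; rewrite /expect3 -expectD; last 2 first.
- by apply: bounded_measurable_expect; exact: bounded_measurable3_expect.
- by apply: bounded_measurable_expect; exact: bounded_measurable3_expect.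
apply: eq_Rintegral => p _; rewrite -expectD; last 2 first.
- by apply: bounded_measurable_expect; exact: bounded_measurable3_section.
- by apply: bounded_measurable_expect; exact: bounded_measurable3_section.
apply: eq_Rintegral => q _; rewrite -expectD//.
- by apply: bounded_measurable_section (bounded_measurable3_section _ bF).
- by apply: bounded_measurable_section (bounded_measurable3_section _ bG).
Qed.

Lemma expect3_swap12 F : bounded_measurable3 F ->
  expect3 F = expect3 (fun p q r => F q p r).
Proof. by move=> bF; exact: expect_swap (bounded_measurable3_expect bF). Qed.

Lemma expect3_swap23 F : bounded_measurable3 F ->
  expect3 F = expect3 (fun p q r => F p r q).
Proof.
move=> bF; apply: eq_Rintegral => p _.
exact: expect_swap (bounded_measurable3_section _ bF).
Qed.

Ltac solve_bounded3 := match goal with |- bounded_measurable3 _ =>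
  rewrite /bounded_measurable3; solve_bounded end.

Definition chain p q r : R := (L p q)%:R * (L q r)%:R.

(** Given the middle point of a chain, its two ends are independent. *)
Lemma expect3_chain : expect3 chain = \int[P]_p (below p * above p).
Proof.
rewrite expect3_swap12; last by solve_bounded3.
apply: eq_Rintegral => p _; rewrite /below -expectZr; last by solve_bounded.
by apply: eq_Rintegral => q _; rewrite expectZ//; solve_bounded.
Qed.

(** Three pairwise comparable elements are linearly ordered in exactly one of
the six possible ways. *)
Lemma triangle_chains p q r :
  comparable p q * (comparable p r * comparable q r) =
  chain p q r + chain p r q + chain q p r + chain q r p + chain r p q
  + chain r q p.
Proof.
rewrite /comparable /chain.
have := (@asymmetric_L p q, @asymmetric_L q r, @asymmetric_L p r).
have := (@transitive_L q p r, @transitive_L r p q, @transitive_L p q r).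
have := (@transitive_L r q p, @transitive_L p r q, @transitive_L q r p).
case: (L p q); case: (L q p); case: (L p r); case: (L r p); case: (L q r);
  case: (L r q) => /= -[[a1 a2] a3] [[b1 b2] b3] [[c1 c2] c3];
  first [ring | exfalso; by auto].
Qed.

Lemma expect3_triangle :
  expect3 (fun p q r => comparable p q * (comparable p r * comparable q r)) =
  6 * \int[P]_p (below p * above p).
Proof.
transitivity (expect3 (fun p q r => chain p q r + chain p r q + chain q p r
    + chain q r p + chain r p q + chain r q p)).
  by do 3 (apply: eq_Rintegral => ? _); exact: triangle_chains.
have bc : bounded_measurable3 chain by solve_bounded3.
have cprq : bounded_measurable3 (fun p q r => chain p r q) by solve_bounded3.
have cqpr : bounded_measurable3 (fun p q r => chain q p r) by solve_bounded3.
have cqrp : bounded_measurable3 (fun p q r => chain q r p) by solve_bounded3.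
have crpq : bounded_measurable3 (fun p q r => chain r p q) by solve_bounded3.
have crqp : bounded_measurable3 (fun p q r => chain r q p) by solve_bounded3.
rewrite -expect3_chain; move: chain bc cprq cqpr cqrp crpq crqp => C.
move=> bc cprq cqpr cqrp crpq crqp.
have prq := expect3_swap23 cprq; have qpr := expect3_swap12 cqpr.
have qrp := etrans (expect3_swap12 cqrp) prq.
have rpq := etrans (expect3_swap23 crpq) qpr.
have rqp := etrans (expect3_swap12 crqp) rpq.
do 5 (rewrite expect3D; [|repeat apply: bounded_measurableD; assumption..]).
rewrite prq qpr qrp rpq rqp; ring.
Qed.

(** Given r, the points p and q are independent. *)
Lemma expect3_cherry :
  expect3 (fun p q r => comparable p r * comparable q r) =
  \int[P]_p comparable_mass p ^+ 2.
Proof.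
rewrite expect3_swap23; last by solve_bounded3.
rewrite expect3_swap12; last by solve_bounded3.
apply: eq_Rintegral => r _; rewrite expr2 {1}/comparable_mass.
rewrite -expectZr; last first.
  by solve_bounded.
apply: eq_Rintegral => p _; rewrite expectZ; last by solve_bounded.
rewrite comparableC; congr (_ * _).
by apply: eq_Rintegral => q _; rewrite comparableC.
Qed.

(** Among the triples with p ~ r and q ~ r, those with p ~ q in addition are the
triangles. *)
Lemma nontransitivityE : nontransitivity =
  \int[P]_p comparable_mass p ^+ 2 - 6 * \int[P]_p (below p * above p).
Proof.
apply/eqP; rewrite eq_sym subr_eq -expect3_triangle -expect3_cherry.
rewrite [X in X + _](_ : _ = expect3 (fun p q r =>
    (1 - comparable p q) * (comparable p r * comparable q r))); last first.
  apply: eq_Rintegral => p _; apply: eq_Rintegral => q _.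
  by rewrite expectZ//; solve_bounded.
apply/eqP; rewrite -expect3D; last 2 first.
- by solve_bounded3.
- by solve_bounded3.
by do 3 (apply: eq_Rintegral => ? _); ring.
Qed.

(** Both sides depend only on E f^2 and E (b a), because (b - a)^2 =
f^2 - 4 b a where f = b + a. *)
Lemma expect_imbalance_sqr : 3 * \int[P]_p (below p - above p) ^+ 2 =
  \int[P]_p comparable_mass p ^+ 2 + 2 * nontransitivity.
Proof.
rewrite nontransitivityE.
have -> : \int[P]_p (below p - above p) ^+ 2 =
    \int[P]_p (comparable_mass p ^+ 2 - 4 * (below p * above p)).
  by apply: eq_Rintegral => p _; rewrite comparable_massE; ring.
rewrite expectB; [|by solve_bounded|by solve_bounded].
by rewrite expectZ; [set a := Rintegral _ _ _; set b := Rintegral _ _ _; ring|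
  solve_bounded].
Qed.

Lemma nontransitivity_ge0 : 0 <= nontransitivity.
Proof.
apply: expect_ge0 => p; apply: expect_ge0 => q; apply: mulr_ge0.
  by rewrite subr_ge0; case/andP: (comparable_01 p q).
exact: common_mass_ge0.
Qed.

Lemma nontransitivity_eq0 : nontransitivity = 0 ->
  \forall p \ae P, \forall q \ae P, (1 - comparable p q) * common_mass p q = 0.
Proof.
have ge0 p q : 0 <= (1 - comparable p q) * common_mass p q.
  apply: mulr_ge0; last exact: common_mass_ge0.
  by rewrite subr_ge0; case/andP: (comparable_01 p q).
move=> /expect_eq0; have /[swap]/[apply] : forall p,
    0 <= \int[P]_q ((1 - comparable p q) * common_mass p q).
  by move=> p; exact: expect_ge0.
have /[swap]/[apply] : bounded_measurable (fun p =>
    \int[P]_q ((1 - comparable p q) * common_mass p q)) by solve_bounded.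
apply: filterS => p; apply: expect_eq0 => //.
by solve_bounded.
Qed.

(** * Comparability classes of equal mass *)

(** Almost everywhere, comparability is an equivalence relation with classes
of mass c.  If c were not the inverse of a natural number (0 included, with
inverse 0), then for every n there would be a union of n classes, of mass n c:
such a union never has mass 1, so some generic point q lies outside it and the
class of q can be added.  This contradicts n c <= 1 for large n.  The unions are
described by functions u with values in [0, 1], closed under comparability in
the sense that for almost every r with u r <> 1 the points comparable to r have
mass 0 in u. *)
Lemma comparable_mass_inverse_nat (c : R) :
  (\forall p \ae P, comparable_mass p = c) -> nontransitivity = 0 ->
  exists n : nat, c = n%:R^-1.
Proof.
move=> fc Z0; apply: contrapT => /forallNP c_neq.
have c_gt0 : 0 < c.
  rewrite lt0r; apply/andP; split.
    by apply/eqP => c0; apply: (c_neq 0); rewrite invr0.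
  have [p <-] := ae_exists fc.
  by apply: expect_ge0 => q; case/andP: (comparable_01 p q).
have trans := nontransitivity_eq0 Z0.
suff unions n : exists u : T -> R, [/\ bounded_measurable u,
    forall p, 0 <= u p <= 1, \int[P]_p u p = n%:R * c
    & \forall r \ae P, (1 - u r) * \int[P]_s (comparable r s * u s) = 0].
  have [n cn] : exists n : nat, c^-1 < n%:R.
    by exists (Num.bound c^-1); apply: archi_boundP; rewrite invr_ge0 ltW.
  have [u [bu u01 intu _]] := unions n.
  have : \int[P]_p u p <= \int[P]_(p in setT) 1.
    apply: le_expect => //; first exact: bounded_measurable_cst.
    by move=> p; case/andP: (u01 p).
  rewrite expect_cst intu leNgt => /negP; apply.
  by rewrite -ltr_pdivrMr// mul1r.
elim: n => [|n [u [bu u01 intu closed_u]]].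
  exists (fun=> 0); split.
  - exact: bounded_measurable_cst.
  - by move=> _; rewrite lexx ler01.
  - by rewrite expect_cst mul0r.
  - apply: aeW => r; rewrite (_ : \int[P]_s _ = 0) ?mulr0//.
    by under eq_Rintegral do rewrite mulr0; rewrite expect_cst.
have u_neq1 : ~ (\forall q \ae P, u q = 1).
  move=> u1; have : \int[P]_p u p = \int[P]_(p in setT) 1.
    by apply: ae_expect => //; exact: bounded_measurable_cst.
  rewrite intu expect_cst => nc1; apply: (c_neq n).
  have n0 : n%:R != 0 :> R by apply/eqP => n0; move: nc1; rewrite n0 mul0r; lra.
  by apply: (mulfI n0); rewrite nc1 divff.
(* A point outside u at which the three almost sure properties hold. *)
have [q [fq trans_q closed_q uq]] : exists q, [/\ comparable_mass q = c,
    \forall r \ae P, (1 - comparable q r) * common_mass q r = 0,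
    (1 - u q) * \int[P]_s (comparable q s * u s) = 0 & u q <> 1].
  apply: contrapT => /forallNP noq; apply: u_neq1.
  apply: filterS3 fc trans closed_u => q fq tq cq.
  by apply: contrapT => uq; apply: (noq q).
have {closed_q} Nqu : \int[P]_s (comparable q s * u s) = 0.
  by move/eqP : closed_q; rewrite mulf_eq0 subr_eq0 => /orP[/eqP/esym//|/eqP].
have bNq := bounded_measurable_comparable q.
have bM := bounded_measurableM.
(* The indicator of the union of the two sets when u is itself an indicator. *)
exists (fun s => (u s + comparable q s) - comparable q s * u s); split.
- apply: bounded_measurableB; last exact: bM.
  exact: bounded_measurableD.
- move=> p; have /andP[u0 u1] := u01 p; have /andP[N0 N1] := comparable_01 q p.
  apply/andP; split; nra.
- rewrite expectB; [|exact: bounded_measurableD|exact: bM].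
  rewrite expectD// intu Nqu -/(comparable_mass q) fq -natr1; ring.
apply: filterS2 closed_u trans_q => r ur tr.
have bNr := bounded_measurable_comparable r.
have bD : bounded_measurable (fun s => u s + comparable q s).
  exact: bounded_measurableD.
have : \int[P]_s (comparable r s * (u s + comparable q s - comparable q s * u s))
    <= \int[P]_s (comparable r s * u s) + common_mass q r.
  rewrite -expectD; [|exact: bM|exact: bM].
  apply: le_expect.
  - by apply: (bM) => //; apply: bounded_measurableB => //; exact: bM.
  - by apply: bounded_measurableD; exact: bM.
  - move=> s; have /andP[u0 u1] := u01 s.
    have /andP[N0 N1] := comparable_01 q s.
    have /andP[M0 M1] := comparable_01 r s.
    have : 0 <= comparable r s * (comparable q s * u s) by rewrite !mulr_ge0.
    lra.
have : 0 <= \int[P]_s (comparable r s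
    * (u s + comparable q s - comparable q s * u s)).
  apply: expect_ge0 => s; have /andP[u0 u1] := u01 s.
  have /andP[N0 N1] := comparable_01 q s; have /andP[M0 M1] := comparable_01 r s.
  apply: mulr_ge0 => //; nra.
(* Only 0 <= X <= a + b is left, where (1 - v) a = 0 and (1 - N) b = 0. *)
set X := Rintegral _ _ _; move: ur tr; set a := Rintegral _ _ _.
have := comparable_01 q r; have := u01 r.
move: (u r) (comparable q r) (common_mass q r) a X => v N b a X.
move=> /andP[v0 v1] /andP[N0 N1] va Nb X0 Xab.
have : (1 - v) * (1 - N) * X <= (1 - v) * (1 - N) * (a + b).
  by rewrite ler_wpM2l// mulr_ge0// subr_ge0.
have -> : (1 - v) * (1 - N) * (a + b) =
  (1 - N) * ((1 - v) * a) + (1 - v) * ((1 - N) * b) by ring.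
rewrite va Nb !mulr0 addr0 => le0.
have ge0 : 0 <= (1 - v) * (1 - N) * X by rewrite !mulr_ge0// subr_ge0.
have -> : 1 - (v + N - N * v) = (1 - v) * (1 - N) by ring.
by apply/eqP; rewrite eq_le le0 ge0.
Qed.

(** In the case of equality the variance of the comparable mass and the
nontransitivity both vanish. *)
Lemma expect_imbalance_sqr_gt :
  (forall n : nat, \int[P]_p comparable_mass p <> n%:R^-1) ->
  (\int[P]_p comparable_mass p) ^+ 2 < 3 * \int[P]_p (below p - above p) ^+ 2.
Proof.
move=> not_inv; rewrite expect_imbalance_sqr ltNge; apply/negP => le_sqr.
set f := comparable_mass; set c := \int[P]_p f p.
have bf : bounded_measurable f := bounded_measurable_comparable_mass.
have var_ge0 := le_sqr_expect P bf.
have Z_ge0 := nontransitivity_ge0.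
have Z0 : nontransitivity = 0.
  by apply/eqP; rewrite eq_le Z_ge0 andbT -/f in le_sqr var_ge0 *; lra.
have f2 : \int[P]_p f p ^+ 2 = c ^+ 2.
  apply/eqP; rewrite eq_le var_ge0 andbT; apply: le_trans le_sqr.
  by rewrite Z0 mulr0 addr0.
have [n cn] := comparable_mass_inverse_nat (ae_cst_of_expect_sqr bf f2) Z0.
exact: not_inv cn.
Qed.

(** * Moments of the uniform law *)

(** If almost all pairs are comparable, there is no intransitive triple, and
b + a = 1 determines b from the imbalance b - a, whose mean is 0 and whose
second moment is 1 / 3. *)
Lemma total_order_moments : (\forall p \ae P, comparable_mass p = 1) ->
  \int[P]_p below p = 1 / 2 /\ \int[P]_p below p ^+ 2 = 1 / 3.
Proof.
move=> f1; have bb := bounded_measurable_below.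
have ba := bounded_measurable_above.
have b1 : \int[P]_p below p = 1 / 2.
  have := expect_comparable_mass.
  rewrite (ae_expect bounded_measurable_comparable_mass
    (bounded_measurable_cst _ 1) f1) expect_cst; lra.
split=> //.
have Z0 : nontransitivity = 0.
  rewrite -[RHS](expect_cst P); apply: ae_expect.
  - by solve_bounded.
  - exact: bounded_measurable_cst.
  apply: filterS f1 => p f1; rewrite -[RHS](expect_cst P); apply: ae_expect.
  - by solve_bounded.
  - exact: bounded_measurable_cst.
  have bN : bounded_measurable (fun q => 1 - comparable p q) by solve_bounded.
  have : \int[P]_q (1 - comparable p q) = 0.
    rewrite expectB; [|exact: bounded_measurable_cst|by solve_bounded].
    by rewrite expect_cst -/(comparable_mass p) f1 subrr.
  move=> /(expect_eq0 bN).
  have /[swap]/[apply] : forall q, 0 <= 1 - comparable p q.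
    by move=> q; rewrite subr_ge0; case/andP: (comparable_01 p q).
  by apply: filterS => q ->; rewrite mul0r.
have := expect_imbalance_sqr; rewrite Z0 mulr0 addr0.
have -> : \int[P]_p comparable_mass p ^+ 2 = 1.
  rewrite -[RHS](expect_cst P); apply: ae_expect.
  - by solve_bounded.
  - exact: bounded_measurable_cst.
  by apply: filterS f1 => p ->; rewrite expr1n.
have -> : \int[P]_p (below p - above p) ^+ 2 =
    \int[P]_p (4 * below p ^+ 2 - 4 * below p + 1).
  apply: ae_expect; try by solve_bounded.
  apply: filterS f1 => p; rewrite comparable_massE => fp.
  by rewrite (_ : above p = 1 - below p); [ring|lra].
rewrite expectD; [|by solve_bounded|by solve_bounded].
rewrite expectB; [|by solve_bounded|by solve_bounded].
rewrite !expectZ ?b1 ?expect_cst; [lra|by solve_bounded|by solve_bounded].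
Qed.

End strict_order.

(** * Concordance and discordance under a copula *)

Section copula_measure.
Variables (R : realType) (A : R -> R -> R).
Local Notation plane := (measurableTypeR R * measurableTypeR R)%type.
Variable P : probability plane R.
Local Notation square := (@unit_square R).

Definition left_of (p q : R * R) := p.1 < q.1.

Definition lower_than (p q : R * R) := p.2 < q.2.

Definition concordant (p q : R * R) := (p.1 < q.1) && (p.2 < q.2).

Definition discordant (p q : R * R) := (p.1 < q.1) && (q.2 < p.2).

Ltac solve_measurable_bool :=
  repeat first [ apply: measurable_and | apply: measurable_fun_ltr
               | apply: measurable_fun_ler | apply: measurable_fun_eqr ];
  solve_measurable.

Lemma measurable_left_of :
  measurable_fun setT (fun z : plane * plane => left_of z.1 z.2).
Proof. by rewrite /left_of; solve_measurable_bool. Qed.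

Lemma measurable_lower_than :
  measurable_fun setT (fun z : plane * plane => lower_than z.1 z.2).
Proof. by rewrite /lower_than; solve_measurable_bool. Qed.

Lemma measurable_concordant :
  measurable_fun setT (fun z : plane * plane => concordant z.1 z.2).
Proof. by rewrite /concordant; solve_measurable_bool. Qed.

Lemma measurable_discordant :
  measurable_fun setT (fun z : plane * plane => discordant z.1 z.2).
Proof. by rewrite /discordant; solve_measurable_bool. Qed.

Hypothesis copula_A : is_copula A.
Hypothesis null_outside : P (~` square) = 0%E.
Hypothesis boxE : forall x y : R, 0 <= x <= 1 -> 0 <= y <= 1 ->
  P (`[0%R, x] `*` `[0%R, y]) = (A x y)%:E.

Lemma measurable_square : measurable (square : set plane).
Proof. by apply: measurableX; exact: measurable_itv. Qed.

Lemma ae_square : \forall p \ae P, 0 <= p.1 <= 1 /\ 0 <= p.2 <= 1.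
Proof.
exists (~` square); split => //; apply: measurableC.
exact: measurable_square.
Qed.

Lemma bounded_measurable_box (x y : R) : bounded_measurable
  (fun q : plane => ((q.1 <= x) && (q.2 <= y))%:R : R).
Proof. by apply: bounded_measurable_bool; solve_measurable_bool. Qed.

Lemma expect_box (x y : R) : 0 <= x <= 1 -> 0 <= y <= 1 ->
  \int[P]_q ((q.1 <= x) && (q.2 <= y))%:R = A x y.
Proof.
move=> x01 y01.
pose B : set plane := `[0%R, x] `*` `[0%R, y].
have mB : measurable B by apply: measurableX; exact: measurable_itv.
have -> : A x y = \int[P]_q \1_B q.
  transitivity (fine (P B)); first by rewrite /B boxE.
  by rewrite /Rintegral integral_indic// setIT.
apply: ae_expect; first exact: bounded_measurable_box.
  split; first exact: measurable_indic.
  by exists 1 => q; rewrite indicE; case: (_ \in _); rewrite ?normr0 ?normr1.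
apply: ae_mono ae_square => q [/andP[q1 _] /andP[q2 _]].
rewrite indicE; congr (nat_of_bool _)%:R; apply/idP/idP.
  by move=> /andP[qx qy]; rewrite inE; split; rewrite /= in_itv/= ?q1 ?q2.
by rewrite inE => -[]; rewrite /= !in_itv/= => /andP[_ ->] /andP[_ ->].
Qed.

Lemma bounded_measurable_left (x : R) :
  bounded_measurable (fun q : plane => (q.1 <= x)%R%:R : R).
Proof. by apply: bounded_measurable_bool; solve_measurable_bool. Qed.

Lemma bounded_measurable_low (y : R) :
  bounded_measurable (fun q : plane => (q.2 <= y)%R%:R : R).
Proof. by apply: bounded_measurable_bool; solve_measurable_bool. Qed.

Lemma expect_left (x : R) : 0 <= x <= 1 -> \int[P]_q (q.1 <= x)%R%:R = x.
Proof.
move=> x01; have [_ margin _] := copula_A.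
rewrite -[RHS](proj1 (margin x x01)) -expect_box ?lexx ?ler01//.
apply: ae_expect.
- exact: bounded_measurable_left.
- exact: bounded_measurable_box.
by apply: ae_mono ae_square => q [_ /andP[_ ->]]; rewrite andbT.
Qed.

Lemma expect_low (y : R) : 0 <= y <= 1 -> \int[P]_q (q.2 <= y)%R%:R = y.
Proof.
move=> y01; have [_ margin _] := copula_A.
rewrite -[RHS](proj2 (margin y y01)) -expect_box ?lexx ?ler01//.
apply: ae_expect.
- exact: bounded_measurable_low.
- exact: bounded_measurable_box.
by apply: ae_mono ae_square => q [/andP[_ ->] _].
Qed.

(** Ties have probability 0, so strict and weak inequalities between
coordinates can be exchanged. *)
Lemma ae_off_lines (p : R * R) : 0 <= p.1 <= 1 -> 0 <= p.2 <= 1 ->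
  \forall q \ae P, q.1 != p.1 /\ q.2 != p.2.
Proof.
move=> p1 p2.
have := uniform_no_atom (g := snd : plane -> R) measurable_snd expect_low p2.
have := uniform_no_atom (g := fst : plane -> R) measurable_fst expect_left p1.
by apply: ae_mono2.
Qed.

Local Notation X := (below P left_of).
Local Notation Y := (below P lower_than).

Ltac solve_bounded :=
  repeat first
    [ assumption | exact: bounded_measurable_cst | exact: bounded_measurable_box
    | exact: bounded_measurable_left | exact: bounded_measurable_low
    | apply: bounded_measurable_bool; solve [solve_measurable_bool]
    | apply: bounded_measurableX
    | apply: bounded_measurableB | apply: bounded_measurableD
    | apply: bounded_measurableM ].

Lemma below_left_of p : 0 <= p.1 <= 1 -> 0 <= p.2 <= 1 -> X p = p.1.
Proof.
move=> p1 p2; rewrite -[RHS]expect_left//; apply: ae_expect;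
  try by solve_bounded.
by apply: ae_mono (ae_off_lines p1 p2) => q [q1 _];
  rewrite /left_of lt_neqAle q1.
Qed.

Lemma below_lower_than p : 0 <= p.1 <= 1 -> 0 <= p.2 <= 1 -> Y p = p.2.
Proof.
move=> p1 p2; rewrite -[RHS]expect_low//; apply: ae_expect;
  try by solve_bounded.
by apply: ae_mono (ae_off_lines p1 p2) => q [_ q2];
  rewrite /lower_than lt_neqAle q2.
Qed.

Lemma above_left_of p : 0 <= p.1 <= 1 -> 0 <= p.2 <= 1 ->
  above P left_of p = 1 - p.1.
Proof.
move=> p1 p2; transitivity (\int[P]_q (1 - (q.1 <= p.1)%R%:R)).
  apply: eq_Rintegral => q _; rewrite /left_of ltNge.
  by case: (q.1 <= p.1) => /=; ring.
rewrite expectB; [|by solve_bounded|by solve_bounded].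
by rewrite expect_cst expect_left.
Qed.

Lemma above_lower_than p : 0 <= p.1 <= 1 -> 0 <= p.2 <= 1 ->
  above P lower_than p = 1 - p.2.
Proof.
move=> p1 p2; transitivity (\int[P]_q (1 - (q.2 <= p.2)%R%:R)).
  apply: eq_Rintegral => q _; rewrite /lower_than ltNge.
  by case: (q.2 <= p.2) => /=; ring.
rewrite expectB; [|by solve_bounded|by solve_bounded].
by rewrite expect_cst expect_low.
Qed.

Lemma below_concordant p : 0 <= p.1 <= 1 -> 0 <= p.2 <= 1 ->
  below P concordant p = A p.1 p.2.
Proof.
move=> p1 p2; rewrite -[RHS]expect_box//; apply: ae_expect;
  try by solve_bounded.
apply: ae_mono (ae_off_lines p1 p2) => q [q1 q2].
by rewrite /concordant !lt_neqAle q1 q2.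
Qed.

Lemma above_concordant p : 0 <= p.1 <= 1 -> 0 <= p.2 <= 1 ->
  above P concordant p = 1 - p.1 - p.2 + A p.1 p.2.
Proof.
move=> p1 p2; transitivity (\int[P]_q (1 - (q.1 <= p.1)%R%:R - (q.2 <= p.2)%R%:R
    + ((q.1 <= p.1) && (q.2 <= p.2))%:R)).
  apply: eq_Rintegral => q _; rewrite /concordant !ltNge.
  by case: (q.1 <= p.1); case: (q.2 <= p.2) => /=; ring.
rewrite expectD; [|by solve_bounded|by solve_bounded].
rewrite expectB; [|by solve_bounded|by solve_bounded].
rewrite expectB; [|by solve_bounded|by solve_bounded].
by rewrite expect_cst expect_left// expect_low// expect_box.
Qed.

Lemma below_discordant p : 0 <= p.1 <= 1 -> 0 <= p.2 <= 1 ->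
  below P discordant p = p.1 - A p.1 p.2.
Proof.
move=> p1 p2; transitivity (\int[P]_q ((q.1 <= p.1)%R%:R
    - ((q.1 <= p.1) && (q.2 <= p.2))%:R)).
  apply: ae_expect; try by solve_bounded.
  apply: ae_mono (ae_off_lines p1 p2) => q [q1 q2].
  rewrite /discordant (lt_neqAle q.1) q1 ltNge /=.
  by case: (q.1 <= p.1); case: (q.2 <= p.2) => /=; ring.
rewrite expectB; [|by solve_bounded|by solve_bounded].
by rewrite expect_left// expect_box.
Qed.

Lemma above_discordant p : 0 <= p.1 <= 1 -> 0 <= p.2 <= 1 ->
  above P discordant p = p.2 - A p.1 p.2.
Proof.
move=> p1 p2; transitivity (\int[P]_q ((q.2 <= p.2)%R%:R
    - ((q.1 <= p.1) && (q.2 <= p.2))%:R)).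
  apply: ae_expect; try by solve_bounded.
  apply: ae_mono (ae_off_lines p1 p2) => q [q1 q2].
  rewrite /discordant (lt_neqAle q.2) q2 ltNge /=.
  by case: (q.1 <= p.1); case: (q.2 <= p.2) => /=; ring.
rewrite expectB; [|by solve_bounded|by solve_bounded].
by rewrite expect_low// expect_box.
Qed.

Lemma ae_unit (Q : plane -> Prop) :
  (forall p : plane, 0 <= p.1 <= 1 -> 0 <= p.2 <= 1 -> Q p) ->
  \forall p \ae P, Q p.
Proof. by move=> HQ; apply: ae_mono ae_square => p [p1 p2]; exact: HQ. Qed.

(** The integrand x y is unbounded on the plane and A is arbitrary outside the
square; g is a bounded measurable substitute for such an f. *)
Lemma expect_square (f g : plane -> R) : bounded_measurable g ->
  (forall p : plane, 0 <= p.1 <= 1 -> 0 <= p.2 <= 1 -> f p = g p) ->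
  \int[P]_(p in square) f p = \int[P]_p g p.
Proof.
move=> bg fg.
have -> : \int[P]_(p in square) f p = \int[P]_(p in square) g p.
  by apply: eq_Rintegral => p; rewrite inE => -[]; rewrite /= !in_itv; exact: fg.
rewrite Rintegral_mkcond; apply: ae_expect => //.
  rewrite (_ : _ \_ _ = fun p => g p * \1_square p).
    apply: bounded_measurableM => //; split.
      exact: measurable_indic measurable_square.
    by exists 1 => q; rewrite indicE; case: (_ \in _); rewrite ?normr0 ?normr1.
  by apply/funext => p; rewrite patchE indicE; case: ifP; rewrite ?mulr1 ?mulr0.
by apply: ae_unit => p p1 p2; rewrite patchE mem_set.
Qed.

Let bX : bounded_measurable X :=
  bounded_measurable_below P measurable_left_of.
Let bY : bounded_measurable Y :=
  bounded_measurable_below P measurable_lower_than.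
Let bA : bounded_measurable (below P concordant) :=
  bounded_measurable_below P measurable_concordant.

Lemma kendall_tauE : kendall_tau A P = 4 * \int[P]_p below P concordant p - 1.
Proof.
by rewrite /kendall_tau (expect_square bA)// => p p1 p2; rewrite below_concordant.
Qed.

Lemma spearman_rhoE : spearman_rho P = 12 * \int[P]_p (X p * Y p) - 3.
Proof.
rewrite /spearman_rho (expect_square (bounded_measurableM bX bY))// => p p1 p2.
by rewrite below_left_of// below_lower_than.
Qed.

(** X p is the abscissa of p almost everywhere, so these are the moments of
the uniform law. *)
Lemma left_of_moments :
  \int[P]_p X p = 1 / 2 /\ \int[P]_p X p ^+ 2 = 1 / 3.
Proof.
apply: total_order_moments measurable_left_of _ _ _.
- by move=> p q; rewrite /left_of -leNgt => /ltW.
- by move=> q p r; rewrite /left_of; exact: lt_trans.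
apply: ae_unit => p p1 p2; rewrite (comparable_massE _ measurable_left_of).
by rewrite above_left_of// below_left_of// subrK.
Qed.

Lemma lower_than_moments :
  \int[P]_p Y p = 1 / 2 /\ \int[P]_p Y p ^+ 2 = 1 / 3.
Proof.
apply: total_order_moments measurable_lower_than _ _ _.
- by move=> p q; rewrite /lower_than -leNgt => /ltW.
- by move=> q p r; rewrite /lower_than; exact: lt_trans.
apply: ae_unit => p p1 p2; rewrite (comparable_massE _ measurable_lower_than).
by rewrite above_lower_than// below_lower_than// subrK.
Qed.

Lemma discordance_mass :
  \int[P]_p comparable_mass P discordant p = (1 - kendall_tau A P) / 2.
Proof.
rewrite (expect_comparable_mass _ measurable_discordant) kendall_tauE.
have -> : \int[P]_p below P discordant p =
    \int[P]_p X p - \int[P]_p below P concordant p.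
  rewrite -expectB//; apply: ae_expect.
  - exact: bounded_measurable_below measurable_discordant.
  - exact: bounded_measurableB.
  apply: ae_unit => p p1 p2.
  by rewrite below_discordant// below_left_of// below_concordant.
have [-> _] := left_of_moments; lra.
Qed.

Lemma concordance_mass :
  \int[P]_p comparable_mass P concordant p = (1 + kendall_tau A P) / 2.
Proof.
by rewrite (expect_comparable_mass _ measurable_concordant) kendall_tauE; lra.
Qed.

Lemma discordance_imbalance :
  3 * \int[P]_p (below P discordant p - above P discordant p) ^+ 2 =
  (1 - spearman_rho P) / 2.
Proof.
have -> : \int[P]_p (below P discordant p - above P discordant p) ^+ 2 =
    \int[P]_p (X p ^+ 2 + Y p ^+ 2 - 2 * (X p * Y p)).
  apply: ae_expect.
  - apply: bounded_measurableX; apply: bounded_measurableB.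
      exact: bounded_measurable_below measurable_discordant.
    exact: bounded_measurable_above measurable_discordant.
  - by solve_bounded.
  apply: ae_unit => p p1 p2.
  rewrite below_discordant// above_discordant// below_left_of//.
  by rewrite below_lower_than//; ring.
have bX2 := bounded_measurableX 2 bX; have bY2 := bounded_measurableX 2 bY.
have bXY := bounded_measurableM bX bY.
rewrite expectB; [|exact: bounded_measurableD|]; last first.
  by apply: bounded_measurableM => //; exact: bounded_measurable_cst.
rewrite expectD// expectZ// spearman_rhoE.
have [_ ->] := left_of_moments; have [_ ->] := lower_than_moments; lra.
Qed.

Lemma concordance_imbalance :
  3 * \int[P]_p (below P concordant p - above P concordant p) ^+ 2 =
  (1 + spearman_rho P) / 2.
Proof.
have -> : \int[P]_p (below P concordant p - above P concordant p) ^+ 2 =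
    \int[P]_p (X p ^+ 2 + Y p ^+ 2 + 2 * (X p * Y p) - (2 * (X p + Y p) - 1)).
  apply: ae_expect.
  - apply: bounded_measurableX; apply: bounded_measurableB.
      exact: bounded_measurable_below measurable_concordant.
    exact: bounded_measurable_above measurable_concordant.
  - by solve_bounded.
  apply: ae_unit => p p1 p2.
  rewrite below_concordant// above_concordant// below_left_of//.
  by rewrite below_lower_than//; ring.
have bX2 := bounded_measurableX 2 bX; have bY2 := bounded_measurableX 2 bY.
have bXY := bounded_measurableM bX bY.
have bD := bounded_measurableD bX bY; have bc := bounded_measurable_cst plane.
rewrite expectB; last 2 first.
- by solve_bounded.
- by solve_bounded.
rewrite expectD; [|exact: bounded_measurableD|exact: bounded_measurableM].
rewrite expectD// expectZ// expectB//; last exact: bounded_measurableM.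
rewrite expectZ// expectD// expect_cst spearman_rhoE.
have [-> ->] := left_of_moments; have [-> ->] := lower_than_moments; lra.
Qed.

Lemma spearman_rho_lt : (forall n : nat, (1 - kendall_tau A P) / 2 <> n%:R^-1) ->
  spearman_rho P < 1 - (1 - kendall_tau A P) ^+ 2 / 2.
Proof.
rewrite -discordance_mass.
move=> /(expect_imbalance_sqr_gt measurable_discordant) H.
have /H/(_ _) : forall p q, discordant p q -> ~~ discordant q p.
  by move=> p q /andP[pq _]; rewrite /discordant (lt_gtF pq).
have tr q p r : discordant p q -> discordant q r -> discordant p r.
  by move=> /andP[p1 p2] /andP[q1 q2];
    rewrite /discordant (lt_trans p1)//= (lt_trans q2).
move=> /(_ tr); rewrite discordance_mass discordance_imbalance.
by set t := kendall_tau A P; lra.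
Qed.

Lemma spearman_rho_gt : (forall n : nat, (1 + kendall_tau A P) / 2 <> n%:R^-1) ->
  (1 + kendall_tau A P) ^+ 2 / 2 - 1 < spearman_rho P.
Proof.
rewrite -concordance_mass.
move=> /(expect_imbalance_sqr_gt measurable_concordant) H.
have /H/(_ _) : forall p q, concordant p q -> ~~ concordant q p.
  by move=> p q /andP[pq _]; rewrite /concordant (lt_gtF pq).
have tr q p r : concordant p q -> concordant q r -> concordant p r.
  by move=> /andP[p1 p2] /andP[q1 q2];
    rewrite /concordant (lt_trans p1)//= (lt_trans p2).
move=> /(_ tr); rewrite concordance_mass concordance_imbalance.
by set t := kendall_tau A P; lra.
Qed.

End copula_measure.

Lemma copula_measure_setT (R : realType) (A : R -> R -> R)
    (mu : {measure set (measurableTypeR R * measurableTypeR R) -> \bar R}) :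
  is_copula A -> is_copula_measure A mu -> mu setT = 1%E.
Proof.
move=> [_ margin _] [outside box].
have msq := @measurable_square R.
rewrite -(setUv (@unit_square R)) measureU ?setICr//; last exact: measurableC.
rewrite -[RHS]adde0; congr (_ + _)%E; last exact: outside.
transitivity (A 1 1)%:E; first by apply: box; rewrite lexx ler01.
by rewrite (proj1 (margin 1 _))// lexx ler01.
Qed.

(** * Strictness of the Durbin-Stuart inequality *)

Theorem mainTheorem4 (R : realType) :
  exists C : set R,
    [/\ countable C,
        C `<=` `[(-1)%R, 1%R]
      & forall (A : R -> R -> R)
          (mu : {measure set (measurableTypeR R * measurableTypeR R)
                   -> \bar R}),
          is_copula A -> is_copula_measure A mu ->
          ~ C (kendall_tau A mu) ->
          (1 + kendall_tau A mu) ^+ 2 / 2 - 1 < spearman_rho mu /\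
          spearman_rho mu < 1 - (1 - kendall_tau A mu) ^+ 2 / 2].
Proof.
(* Both families of exceptional values, 1 - 2 / n and 2 / n - 1; the index n = 0
   gives 1 and -1, since 0^-1 = 0. *)
exists (range (fun sn : bool * nat => (-1) ^+ sn.1 * (1 - 2 * sn.2%:R^-1))); split.
- exact: sub_countable (card_image_le _ _) (countableP _).
- move=> _ [[s n] _ <-] /=.
  have n0 : 0 <= n%:R^-1 :> R by rewrite invr_ge0.
  have n1 : n%:R^-1 <= 1 :> R.
    by case: n {n0} => [|n]; rewrite ?invr0 ?ler01// invf_le1 ?ltr0n// ler1n.
  by rewrite in_itv/=; case: s => /=; apply/andP; split; lra.
move=> A mu copA muA; have mu1 := copula_measure_setT copA muA.
have [outside box] := muA.
have -> : kendall_tau A mu = kendall_tau A (unit_mass_probability mu1) by [].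
have -> : spearman_rho mu = spearman_rho (unit_mass_probability mu1) by [].
move=> notC; split.
  apply: (spearman_rho_gt (P := unit_mass_probability mu1) copA outside box)
    => n tau_n; apply: notC.
  by exists (true, n) => //=; lra.
apply: (spearman_rho_lt (P := unit_mass_probability mu1) copA outside box)
    => n tau_n; apply: notC.
by exists (false, n) => //=; lra.
Qed.
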